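(* There exists an additive $(52,4,1)$-design that is both $1$-rotational and resolvable.
   Context: A $(v,k,1)$-design is a pair $(V,\mathcal{B})$ with $V$ a $v$-set and $\mathcal{B}$ a collection of $k$-subsets (blocks) such that every pair of distinct points lies in exactly one block. A design is additive if, for some abelian group $G$, up to isomorphism its points are elements of $G$ and every block is zero-sum in $G$. An automorphism of a design is a permutation of $V$ leaving $\mathcal{B}$ invariant; the design is $1$-rotational if it has an automorphism fixing one point and cyclically permuting all the others. A design is resolvable if $\mathcal{B}$ can be partitioned into classes each of which is a partition of $V$. *)

(* Defs.v *)
From HB Require Import structures.
From mathcomp Require Import all_boot all_order all_algebra all_fingroup.
Set Implicit Arguments.
Unset Strict Implicit.
Unset Printing Implicit Defensive.

Import GRing.Theory.

(* A (v,k,1)-design is given by its point set, the finite type V, and its set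
   of blocks B. *)
Definition is_design (V : finType) (v k : nat) (B : {set {set V}}) : Prop :=
  [/\ #|V| = v,
      forall b : {set V}, b \in B -> #|b| = k
    & forall x y : V, x != y ->
        exists! b : {set V}, [/\ b \in B, x \in b & y \in b]].

(* The injection f realizes the design isomorphically on the subset f(V) of G,
   the block b becoming f(b), whose sum is the sum of f over b. *)
Definition additive_design (V : finType) (B : {set {set V}}) : Prop :=
  exists (G : zmodType) (f : V -> G),
    injective f /\
    forall b : {set V}, b \in B -> (\sum_(x in b) f x = 0)%R.

Definition design_automorphism (V : finType) (B : {set {set V}})
    (s : {perm V}) : Prop :=
  [set s @: (b : {set V}) | b in B] = B.

(* The last conjunct says that all the points other than c form one cycle of
   s. *)
Definition one_rotational (V : finType) (B : {set {set V}}) : Prop :=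
  exists (s : {perm V}) (c : V),
    [/\ design_automorphism B s,
        s c = c
      & forall x : V, x != c -> porbit s x = [set~ c]].

(* P is the resolution: a partition of B into parallel classes. *)
Definition resolvable_design (V : finType) (B : {set {set V}}) : Prop :=
  exists P : {set {set {set V}}},
    partition P B /\
    forall C : {set {set V}}, C \in P -> partition C [set: V].

(* Main.v *)
Require Import Defs.
From mathcomp Require Import all_boot.
From mathcomp Require Import ssralg matrix fingroup perm.

Set Implicit Arguments.
Unset Strict Implicit.
Unset Printing Implicit Defensive.

(** In F_256, let zeta generate the group of 51st roots of unity. The 52
points 0 and zeta^i are the x with x^17 in F_4: they form a Denniston maximal
arc, which every affine line over F_16 meets in 0 or 4 points, and the blocks
are the 4-point intersections. On a line, x^17 in F_4 is the vanishing of an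
affine 2-polynomial, so a block is an affine F_2-plane and sums to zero in
F_256. Multiplication by zeta fixes 0 and permutes the other points cyclically,
and the 17 directions of lines give the parallel classes. After passing to the
exponents i, what is left is a finite verification. *)

(** * Exponent model of the arc and its blocks *)

Notation point := 'I_52.

(* [51] stands for the zero of F_256, and [i < 51] for zeta^i. *)
Definition shift (k x : nat) : nat := if x < 51 then (x + k) %% 51 else x.

(* The blocks whose direction is that of the line F_16. The other ones are the
   images of {1, 12, 16, 39} under the Frobenius i |-> 2i and i |-> i + 17. *)
Definition class0 : seq (seq nat) :=
  [:: 51; 0; 17; 34] ::
  [seq map (shift (17 * k)) b
     | k <- iota 0 3,
       b <- [:: [:: 1; 12; 16; 39]; [:: 2; 24; 32; 27];
                [:: 4; 48; 13; 3]; [:: 8; 45; 26; 6]]].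

(** Since zeta^17 lies in F_4, inside F_16, shifts by multiples of 17 keep the direction F_16, while
    [k < 17] reaches each of the 17 directions once. *)
Definition classes : seq (seq (seq nat)) :=
  [seq map (map (shift k)) class0 | k <- iota 0 17].

Definition blocks : seq (seq nat) := flatten classes.

(* The absolute trace of zeta^i, for i = 0, ..., 50, where zeta = alpha^5 and
   alpha^8 = alpha^4 + alpha^3 + alpha^2 + 1. *)
Definition trace_word : seq nat :=
  [:: 0;1;1;1;1;0;1;0;1;0;0;1;1;1;0;0;1;0;0;1;0;0;1;1;1;1;1;1;0;0;0;1;1;0;0;1;
      0;1;1;1;0;1;0;1;1;1;1;1;1;1;1].

(* Tr (zeta^j z), z being the field element labelled x: for [j < 8] these are
   F_2-coordinates on F_256, because zeta has degree 8 over F_2. *)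
Definition coord (j x : nat) : bool :=
  (x < 51) && (nth 0 trace_word ((x + j) %% 51) == 1).

(** * Finite verifications *)

Lemma blocks_wf :
  all (fun l => [&& uniq l, all (fun x => x < 52) l & size l == 4]) blocks.
Proof. by vm_compute. Qed.

Lemma pair_in_one_block :
  all (fun x => let bx := [seq l <- blocks | x \in l] in
     all (fun y => (x == y) || (size [seq l <- bx | y \in l] == 1))
         (iota 0 52)) (iota 0 52).
Proof. by vm_compute. Qed.

Lemma coord_separates :
  all (fun x => all (fun y =>
     (x == y) || has (fun j => coord j x != coord j y) (iota 0 8))
     (iota 0 52)) (iota 0 52).
Proof. by vm_compute. Qed.

(** Folding over all 52 labels instead of over [l] gives the term to which a big sum in [bool]
    unfolds, so [design_additive] can use it by conversion. *)
Lemma coord_zero_sum :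
  all (fun l => all (fun j =>
     ~~ foldr (fun x a => if x \in l then coord j x (+) a else a)
          false (iota 0 52)) (iota 0 8)) blocks.
Proof. by vm_compute. Qed.

Lemma blocks_shift :
  all (fun l => has (perm_eq (map (shift 1) l)) blocks) blocks.
Proof. by vm_compute. Qed.

(** Serves at two levels: the blocks of one class, and the classes as lists of blocks. *)
Definition disjoint_family (T : eqType) (ss : seq (seq T)) : bool :=
  all (fun s : seq T => all (fun t : seq T => (s == t) || ~~ has (mem t) s) ss)
      ss.

Lemma disjoint_family_eq (T : eqType) (ss : seq (seq T)) (s t : seq T) (x : T) :
  disjoint_family ss -> s \in ss -> t \in ss -> x \in s -> x \in t -> s = t.
Proof.
move=> ssP ss_s ss_t xs xt; have := allP (allP ssP _ ss_s) _ ss_t.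
by case/orP=> [/eqP// | /hasPn/(_ _ xs)]; rewrite /= xt.
Qed.

Lemma classes_parallel :
  all (fun c => disjoint_family c && all (mem (flatten c)) (iota 0 52)) classes.
Proof. by vm_compute. Qed.

Lemma classes_disjoint : disjoint_family classes.
Proof. by vm_compute. Qed.

Arguments blocks : simpl never.
Local Opaque classes.

(** * From lists of labels to a design *)

Lemma mem_point (x : point) : (x : nat) \in iota 0 52.
Proof. by rewrite mem_iota ltn_ord. Qed.

Definition block_of (l : seq nat) : {set point} :=
  [set x : point | (x : nat) \in l].

Definition design : {set {set point}} := [set:: map block_of blocks].

Lemma set_mapP (T : eqType) (U : finType) (f : T -> U) (s : seq T) (y : U) :
  reflect (exists2 x, x \in s & y = f x) (y \in [set:: map f s]).
Proof. by rewrite in_set; apply: mapP. Qed.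

Lemma designP (b : {set point}) :
  reflect (exists2 l, l \in blocks & b = block_of l) (b \in design).
Proof. exact: set_mapP. Qed.

Lemma blocks_sound (l : seq nat) : l \in blocks ->
  [/\ uniq l, all (fun x => x < 52) l & size l = 4].
Proof. by move/(allP blocks_wf) => /and3P[? ? /eqP]. Qed.

Lemma card_block_of (l : seq nat) :
  uniq l -> all (fun x => x < 52) l -> #|block_of l| = size l.
Proof.
move=> Ul ltl.
(* All labels are below 52, so [insub] drops none. *)
have -> : size l = size (pmap (insub : nat -> option point) l).
  by rewrite size_pmap_sub; move: ltl; rewrite all_count => /eqP.
rewrite -(card_uniqP (pmap_sub_uniq _ Ul)).
by apply: eq_card => x; rewrite inE mem_pmap_sub.
Qed.

(** A singleton filter yields existence and uniqueness at once: any listed block through both points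
    is a member of [[:: l]]. *)
Lemma block_through (x y : point) : x != y ->
  exists l,
    [seq m <- blocks | ((y : nat) \in m) && ((x : nat) \in m)] = [:: l].
Proof.
move=> neq.
have /negbTE neqn : (x : nat) != y := neq.
have := allP (allP pair_in_one_block _ (mem_point x)) _ (mem_point y).
have -> : [seq m <- blocks | ((y : nat) \in m) && ((x : nat) \in m)]
    = [seq m <- [seq m <- blocks | (x : nat) \in m] | (y : nat) \in m].
  by rewrite -filter_predI.
by rewrite /= neqn /=; case: filter => [|l []] // _; exists l.
Qed.

Lemma mem_blocks_pair (x y : nat) (l : seq nat) :
  (l \in [seq m <- blocks | (y \in m) && (x \in m)])
    = [&& y \in l, x \in l & l \in blocks].
Proof. by rewrite mem_filter andbA. Qed.

Lemma design_is_design : is_design 52 4 design.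
Proof.
split=> [|b /designP[l /blocks_sound[Ul ltl szl] ->]|x y neq].
- exact: card_ord.
- by rewrite card_block_of.
have [l defl] := block_through neq.
have := mem_head l [::]; rewrite -defl mem_blocks_pair => /and3P[yl xl Bl].
exists (block_of l); split.
  by split; [apply/designP; exists l | rewrite inE | rewrite inE].
move=> _ [/designP[m Bm ->]]; rewrite 2!in_set => xm ym; congr block_of.
by apply/esym/eqP; rewrite -mem_seq1 -defl mem_blocks_pair ym xm.
Qed.

(** A block has two distinct points, and only one list contains both; so no block is listed in two
    different orders. *)
Lemma block_of_inj : {in blocks &, injective block_of}.
Proof.
move=> l m Bl Bm eqlm; have [Ul ltl szl] := blocks_sound Bl.
have /card_gt1P[x [y [xl yl neq]]]: 1 < #|block_of l| by rewrite card_block_of ?szl.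
have [k defk] := block_through neq.
have in_k n : n \in blocks -> block_of l = block_of n -> n = k.
  move=> Bn eqn; apply/eqP; rewrite -mem_seq1 -defk mem_blocks_pair Bn.
  by move: xl yl; rewrite eqn !inE => -> ->.
by rewrite (in_k l) // (in_k m).
Qed.

(** * Embedding in F_2^8 *)

Lemma design_additive : additive_design design.
Proof.
(* [bool] under exclusive or is F_2, and the eight traces identify the additive group of F_256 with
   F_2^8. *)
exists 'rV[bool]_8, (fun x : point => \row_j coord j x)%R; split.
  move=> x y /rowP eqxy; apply/val_inj/eqP.
  have := allP (allP coord_separates _ (mem_point x)) _ (mem_point y).
  case/orP=> // /hasP[j]; rewrite mem_iota => /= ltj8.
  by have := eqxy (Ordinal ltj8); rewrite !mxE => ->; rewrite eqxx.
move=> _ /designP[l Bl ->]; apply/rowP=> j; rewrite summxE mxE.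
have j8 : (j : nat) \in iota 0 8 by rewrite mem_iota ltn_ord.
have /negbTE sum0 := allP (allP coord_zero_sum _ Bl) _ j8.
transitivity (\sum_(0 <= i < 52 | i \in l) coord j i)%R.
  by rewrite big_mkord; apply: eq_big => [x|x _]; rewrite ?inE ?mxE.
by rewrite unlock; exact: sum0.
Qed.

(** * Multiplication by zeta *)

Lemma shift_lt (x : point) : shift 1 x < 52.
Proof. by rewrite /shift; case: ifP => // _; rewrite ltnS ltnW // ltn_mod. Qed.

Definition rot (x : point) : point := Ordinal (shift_lt x).

Lemma shiftE (k x : nat) : x < 51 -> shift k x = (x + k) %% 51.
Proof. by rewrite /shift => ->. Qed.

Lemma val_iter_rot (k : nat) (x : point) :
  x < 51 -> iter k rot x = (x + k) %% 51 :> nat.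
Proof.
move=> ltx; elim: k => [|k IHk]; first by rewrite addn0 modn_small.
by rewrite iterS /= IHk shiftE ?ltn_mod // modnDml addn1 addnS.
Qed.

Lemma point_neq_max (x : point) : (x != ord_max) = (x < 51).
Proof. by rewrite -val_eqE /= ltn_neqAle -ltnS ltn_ord andbT. Qed.

Lemma rot_max : rot ord_max = ord_max.
Proof. exact: val_inj. Qed.

Lemma iter_rot51 (x : point) : iter 51 rot x = x.
Proof.
have [->|] := eqVneq x ord_max; first by rewrite iter_fix ?rot_max.
rewrite point_neq_max => ltx; apply: ord_inj.
by rewrite val_iter_rot // modnDr modn_small.
Qed.

Lemma rot_inj : injective rot.
Proof. by apply: (can_inj (g := iter 50 rot)) => x; rewrite -iterSr iter_rot51. Qed.

Lemma rot_block (l : seq nat) : l \in blocks ->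
  exists2 m, m \in blocks & rot @: block_of l = block_of m.
Proof.
move=> Bl; have /hasP[m Bm eqm] := allP blocks_shift _ Bl.
have [Ul ltl szl] := blocks_sound Bl; have [Um ltm szm] := blocks_sound Bm.
exists m => //; apply/eqP; rewrite eqEcard (card_imset _ rot_inj).
rewrite !card_block_of // szl szm leqnn andbT.
apply/subsetP=> _ /imsetP[x + ->]; rewrite !inE => xl.
by rewrite -(perm_mem eqm); exact: (map_f (shift 1)).
Qed.

Lemma design_one_rotational : one_rotational design.
Proof.
exists (perm rot_inj), ord_max; split.
- apply/eqP; rewrite eqEcard card_imset ?leqnn ?andbT; last first.
    exact/imset_inj/perm_inj.
  apply/subsetP=> _ /imsetP[_ /designP[l Bl ->] ->]; apply/designP.
  have [m Bm eqm] := rot_block Bl; exists m => //.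
  by rewrite -eqm; apply: eq_imset => x; rewrite permE.
- by rewrite permE rot_max.
move=> x; rewrite point_neq_max => ltx.
have iter_perm k : (perm rot_inj ^+ k)%g x = iter k rot x.
  by rewrite permX; apply: eq_iter => z; rewrite permE.
apply/setP=> y; rewrite !inE point_neq_max.
apply/porbitP/idP=> [[k ->]|lty].
  by rewrite iter_perm val_iter_rot // ltn_mod.
(* This is [y - x] modulo 51, with 51 added to avoid truncated subtraction. *)
exists (y + (51 - x)); rewrite iter_perm; apply: ord_inj.
by rewrite val_iter_rot // addnCA subnKC 1?ltnW // modnDr modn_small.
Qed.

(** * Parallel classes *)

Definition class_of (c : seq (seq nat)) : {set {set point}} :=
  [set:: map block_of c].

Lemma class_ofP (c : seq (seq nat)) (b : {set point}) :
  reflect (exists2 l, l \in c & b = block_of l) (b \in class_of c).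
Proof. exact: set_mapP. Qed.

Lemma class_sub (c : seq (seq nat)) : c \in classes -> {subset c <= blocks}.
Proof. by move=> cl_c l cl; apply/flattenP; exists c. Qed.

Lemma class_cover (c : seq (seq nat)) (x : point) : c \in classes ->
  exists2 l, l \in c & x \in block_of l.
Proof.
move=> /(allP classes_parallel)/andP[_ /allP/(_ _ (mem_point x))/flattenP[l cl xl]].
by exists l; rewrite // inE.
Qed.

Lemma class_partition (c : seq (seq nat)) :
  c \in classes -> partition (class_of c) [set: point].
Proof.
move=> cl_c; have /andP[disc _] := allP classes_parallel _ cl_c.
apply/and3P; split.
- apply/eqP/setP=> x; rewrite inE; apply/bigcupP.
  have [l cl xl] := class_cover x cl_c.
  by exists (block_of l) => //; apply/class_ofP; exists l.
- apply/trivIsetP=> _ _ /class_ofP[l cl ->] /class_ofP[m cm ->].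
  apply: contraR => /pred0Pn[x /andP[/=]]; rewrite !inE => xl xm.
  by rewrite (disjoint_family_eq disc cl cm xl xm).
apply/class_ofP=> -[l /(class_sub cl_c)/blocks_sound[Ul ltl szl] l0].
by have := card_block_of Ul ltl; rewrite -l0 cards0 szl.
Qed.

Lemma design_resolvable : resolvable_design design.
Proof.
exists [set:: map class_of classes]; split; last first.
  by move=> _ /set_mapP[c cl_c ->]; exact: class_partition.
apply/and3P; split.
- apply/eqP/setP=> b; apply/bigcupP/designP.
    case=> _ /set_mapP[c cl_c ->] /class_ofP[l cl ->].
    by exists l; rewrite // (class_sub cl_c).
  case=> l /flattenP[c cl_c cl] ->.
  by exists (class_of c); [apply/set_mapP; exists c | apply/class_ofP; exists l].
- apply/trivIsetP=> _ _ /set_mapP[c cl_c ->] /set_mapP[d cl_d ->].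
  apply: contraR => /pred0Pn[b /andP[/= /class_ofP[l cl ->] /class_ofP[m dm]]].
  (* A set common to two classes comes from a common list, which [classes_disjoint] excludes for
     distinct classes. *)
  move/(block_of_inj (class_sub cl_c cl) (class_sub cl_d dm)) => eqlm.
  rewrite -eqlm in dm.
  by rewrite (disjoint_family_eq classes_disjoint cl_c cl_d cl dm).
(* A class is nonempty because it covers a point, here the zero of F_256. *)
apply/set_mapP=> -[c cl_c c0]; have [l cl _] := class_cover ord_max cl_c.
by have := in_set0 (block_of l); rewrite c0; move/class_ofP; case; exists l.
Qed.

Theorem theorem3p1 :
  exists (V : finType) (B : {set {set V}}),
    [/\ is_design 52 4 B,
        additive_design B,
        one_rotational B
      & resolvable_design B].
Proof.
exists point, design; split.
- exact: design_is_design.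
- exact: design_additive.
- exact: design_one_rotational.
- exact: design_resolvable.
Qed.
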